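(* There exist unicyclic tripartite graphs $G$ with $\chi_{lat}(G)=3$, and there exist bicyclic tripartite graphs $H$ with $\chi_{lat}(H)=3$.
   Context: All graphs are finite, simple and loopless. For integers $a<b$, $[a,b]=\{a,a+1,\ldots,b\}$. Let $G=(V,E)$ be a connected graph with $p$ vertices and $q$ edges. For a bijection $f:V(G)\cup E(G)\to[1,p+q]$, the weight of a vertex $u$ is $w(u)=f(u)+\sum_{e\in E(u)} f(e)$, where $E(u)$ is the set of edges incident to $u$. The bijection $f$ is a local antimagic total labeling of $G$ if $w(u)\ne w(v)$ for every pair of adjacent vertices $u,v$. The local antimagic total chromatic number $\chi_{lat}(G)$ is the minimum, over all local antimagic total labelings $f$ of $G$, of the number of distinct vertex weights $w(u)$, $u\in V(G)$, induced by $f$. A unicyclic graph is a connected graph whose number of edges equals its number of vertices; a bicyclic graph is a connected graph whose number of edges equals its number of vertices plus one. A graph is tripartite here if its (ordinary vertex) chromatic number is $3$, i.e. its vertex set can be partitioned into three independent sets but not into fewer. *)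

(* Defs.v *)
From mathcomp Require Import all_boot.

Set Implicit Arguments.
Unset Strict Implicit.
Unset Printing Implicit Defensive.

Record sgraph := SGraph {
  vertex :> finType;
  adj : rel vertex;
  adj_sym : symmetric adj;
  adj_irrefl : irreflexive adj
}.

Definition edges (G : sgraph) : {set {set G}} :=
  [set e : {set G} | [exists x : G, exists y : G, adj x y && (e == [set x; y])]].

Definition edge (G : sgraph) := {e : {set G} | e \in edges G}.

Definition connected (G : sgraph) : Prop :=
  0 < #|G| /\ forall x y : G, connect (@adj G) x y.

Definition unicyclic (G : sgraph) : Prop :=
  connected G /\ #|edges G| = #|G|.

Definition bicyclic (G : sgraph) : Prop :=
  connected G /\ #|edges G| = #|G|.+1.

Definition colorable (G : sgraph) (k : nat) : bool :=
  [exists c : {ffun G -> 'I_k},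
     [forall x : G, forall y : G, adj x y ==> (c x != c y)]].

Lemma colorable_ex (G : sgraph) : exists k, colorable G k.
Proof.
exists #|G|; apply/existsP; exists [ffun x => enum_rank x].
apply/forallP=> x; apply/forallP=> y; apply/implyP=> xy.
rewrite !ffunE (inj_eq enum_rank_inj).
by apply: contraTneq xy => ->; rewrite adj_irrefl.
Qed.

Definition chromatic_number (G : sgraph) : nat := ex_minn (colorable_ex G).

Definition tripartite (G : sgraph) : Prop := chromatic_number G = 3.

Definition total_labeling (G : sgraph) (f : G + edge G -> nat) : Prop :=
  injective f /\
  forall k : nat, (k \in codom f) = (1 <= k <= #|G| + #|edges G|).

Definition weight (G : sgraph) (f : G + edge G -> nat) (u : G) : nat :=
  f (inl u) + \sum_(e : edge G | u \in val e) f (inr e).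

Definition local_antimagic_total (G : sgraph) (f : G + edge G -> nat) : Prop :=
  total_labeling f /\
  forall u v : G, adj u v -> weight f u <> weight f v.

Definition num_weights (G : sgraph) (f : G + edge G -> nat) : nat :=
  size (undup [seq weight f u | u : G]).

(* [chi_lat G k] is the relation "the minimum defining the local antimagic
   total chromatic number of G is attained and equals k". *)
Definition chi_lat (G : sgraph) (k : nat) : Prop :=
  (exists f : G + edge G -> nat,
     local_antimagic_total f /\ num_weights f = k) /\
  (forall f : G + edge G -> nat,
     local_antimagic_total f -> k <= num_weights f).

(* Main.v *)
Require Import Defs.
From mathcomp Require Import all_boot.

(** The triangle is unicyclic, and the complete graph on four vertices minus
an edge is bicyclic; both witness the theorem.

Equality with 3 comes from a sandwich.  The weights of a local antimagic total
labeling form a proper vertex colouring ([chromatic_number_le_num_weights]),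
and a colouring separates the vertices of a triangle ([clique_le_colorable]).
So in a graph containing a triangle the chromatic number and the number of
weights of every local antimagic labeling are at least 3, and exhibiting one
such labeling with at most three weights forces both the chromatic number and
the minimal number of weights to be 3 ([tripartite_chi_lat3]).  In
the triangle any local antimagic labeling will do; in the other graph the two
nonadjacent vertices must receive the same weight.

A graph and a total labeling of it are encoded together in a symmetric matrix
of naturals: vertex labels on the diagonal, edge labels off it, and 0 for
nonadjacent pairs, which is unambiguous because labels are positive.  The
weight of a vertex is then the sum of its row ([weight_mx_label]), so that the
two examples reduce to arithmetic on small matrices. *)

Set Implicit Arguments.
Unset Strict Implicit.
Unset Printing Implicit Defensive.

(** * Lower bounds from colourings *)

Lemma clique_le_colorable (G : sgraph) (s : seq G) (k : nat) :
  uniq s -> {in s &, forall x y, x != y -> adj x y} ->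
  colorable G k -> size s <= k.
Proof.
move=> us cl /existsP[c /forallP cP].
rewrite -(size_map c) -[k in _ <= k]card_ord -(card_uniqP _) ?max_card //.
rewrite map_inj_in_uniq // => x y xs ys cxy; apply/eqP/negPn/negP => nxy.
by have /implyP/(_ (cl x y xs ys nxy)) := forallP (cP x) y; rewrite cxy eqxx.
Qed.

(** Adjacent vertices have distinct weights, so sending a vertex to the rank
of its weight is a proper colouring. *)
Lemma colorable_num_weights (G : sgraph) (f : G + edge G -> nat) :
  local_antimagic_total f -> colorable G (num_weights f).
Proof.
case=> _ wP; set ws := undup [seq weight f u | u : G].
have wsP u : weight f u \in ws by rewrite mem_undup; apply: image_f.
have ltw u : index (weight f u) ws < num_weights f by rewrite index_mem.
apply/existsP; exists [ffun u => Ordinal (ltw u)].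
apply/forallP=> x; apply/forallP=> y; apply/implyP=> xy.
rewrite !ffunE; apply/eqP => /(congr1 val) /= exy.
exact: (wP x y xy (index_inj 0 (wsP x) (wsP y) exy)).
Qed.

Lemma chromatic_number_le (G : sgraph) (k : nat) :
  colorable G k -> chromatic_number G <= k.
Proof. by rewrite /chromatic_number; case: ex_minnP => m _; apply. Qed.

Lemma chromatic_number_colorable (G : sgraph) :
  colorable G (chromatic_number G).
Proof. by rewrite /chromatic_number; case: ex_minnP. Qed.

Lemma chromatic_number_le_num_weights (G : sgraph) (f : G + edge G -> nat) :
  local_antimagic_total f -> chromatic_number G <= num_weights f.
Proof. by move/colorable_num_weights/chromatic_number_le. Qed.

Lemma tripartite_chi_lat3 (G : sgraph) (x y z : G) (f : G + edge G -> nat) :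
  adj x y -> adj x z -> adj y z ->
  local_antimagic_total f -> num_weights f <= 3 ->
  tripartite G /\ chi_lat G 3.
Proof.
move=> xy xz yz fP f3.
have neq (u v : G) : adj u v -> u != v.
  by apply: contraTneq => ->; rewrite adj_irrefl.
have chi_ge3 : 3 <= chromatic_number G.
  apply: (@clique_le_colorable G [:: x; y; z]).
  - by rewrite /= !inE negb_or !neq.
  - move=> u v; rewrite !inE => /or3P[] /eqP-> /or3P[] /eqP->;
      by rewrite ?eqxx // 1?adj_sym.
  - exact: chromatic_number_colorable.
have lower g : local_antimagic_total g -> 3 <= @num_weights G g.
  by move=> gP; apply: leq_trans chi_ge3 (chromatic_number_le_num_weights gP).
split; last first.
  by split=> //; exists f; split=> //; apply/eqP; rewrite eqn_leq f3 lower.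
apply/eqP; rewrite eqn_leq chi_ge3 andbT.
exact: leq_trans (chromatic_number_le_num_weights fP) f3.
Qed.

Lemma connected_universal (G : sgraph) (x : G) :
  (forall y : G, y != x -> adj x y) -> connected G.
Proof.
move=> xP; split; first by apply/card_gt0P; exists x.
have from_x y : connect (@adj G) x y.
  by have [->|/xP] := eqVneq y x; [apply: connect0 | apply: connect1].
move=> y z; apply: connect_trans (from_x z).
by rewrite (sym_connect_sym (@adj_sym G)).
Qed.

(** * Labeled graphs as symmetric matrices *)

Section LabelMatrix.

Variables (n : nat) (L : 'I_n -> 'I_n -> nat).
Hypothesis L_sym : forall x y, L x y = L y x.

Definition mx_adj : rel 'I_n := fun x y => (x != y) && (0 < L x y).

Lemma mx_adj_sym : symmetric mx_adj.
Proof. by move=> x y; rewrite /mx_adj eq_sym L_sym. Qed.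

Lemma mx_adj_irrefl : irreflexive mx_adj.
Proof. by move=> x; rewrite /mx_adj eqxx. Qed.

Definition mx_graph : sgraph := SGraph mx_adj_sym mx_adj_irrefl.

(** The label of an edge is read off at an arbitrary ordering of its two ends,
which is harmless since [L] is symmetric ([pair_labelE]); the default 0 is only reached on sets that are not pairs. *)
Definition pair_label (e : {set 'I_n}) : nat :=
  if [pick p : 'I_n * 'I_n | e == [set p.1; p.2]] is Some p
  then L p.1 p.2 else 0.

Definition mx_label (a : mx_graph + edge mx_graph) : nat :=
  match a with inl x => L x x | inr e => pair_label (val e) end.

Lemma set2_inj (T : finType) (a b x y : T) :
  [set a; b] = [set x; y] -> (a = x /\ b = y) \/ (a = y /\ b = x).
Proof.
move=> E.
have := set21 a b; have := set22 a b; rewrite E !inE.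
have := set21 x y; have := set22 x y; rewrite -E !inE.
by move=> /orP[] /eqP-> /orP[] /eqP-> /orP[] /eqP e1 /orP[] /eqP e2; subst; auto.
Qed.

Lemma pair_labelE x y : pair_label [set x; y] = L x y.
Proof.
rewrite /pair_label; case: pickP => [[a b] /= /eqP/set2_inj|/(_ (x, y))].
  by case=> -[-> ->].
by rewrite eqxx.
Qed.

Lemma mem_mx_edges x y : ([set x; y] \in edges mx_graph) = mx_adj x y.
Proof.
rewrite inE; apply/existsP/idP => [[a /existsP[b /andP[ab /eqP]]]|xy].
  by case/set2_inj=> -[-> ->] //; rewrite mx_adj_sym.
by exists x; apply/existsP; exists y; rewrite eqxx andbT.
Qed.

(** The other end of an edge at [u] determines the edge, so the edge labels
at [u] are the nonzero off-diagonal entries of its row; the zero entries of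
nonadjacent pairs do not change the sum. *)
Lemma weight_mx_label (u : mx_graph) : weight mx_label u = \sum_v L u v.
Proof.
rewrite /weight [RHS](bigD1 u) //=; congr (_ + _).
rewrite [RHS](bigID (fun v => 0 < L u v)) /= [X in _ = _ + X]big1 ?addn0; last first.
  by move=> v /andP[_]; rewrite -eqn0Ngt => /eqP.
rewrite -(big_sub_cond (edges mx_graph) (fun e => u \in e) pair_label) /=.
pose A := [set v | (v != u) && (0 < L u v)].
transitivity (\sum_(e in [set [set u; v] | v in A]) pair_label e).
  apply: eq_bigl => e; apply/andP/imsetP => [[]|[v]].
    rewrite inE => /existsP[a /existsP[b /andP[ab /eqP->]]].
    have /andP[nab Lab] : mx_adj a b by [].
    rewrite !inE => /orP[] /eqP uE; [exists b | exists a]; rewrite ?inE uE.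
    - by rewrite eq_sym nab.
    - by [].
    - by rewrite nab L_sym.
    - by rewrite setUC.
  rewrite inE => /andP[vu Luv] ->; split; last exact: set21.
  by rewrite mem_mx_edges /mx_adj eq_sym vu.
rewrite big_imset /=.
  by apply: eq_big => [v|v _]; rewrite ?inE ?pair_labelE.
by move=> v w _ _ /set2_inj[[]|[-> ->]].
Qed.

Lemma card_mx_edges :
  #|edges mx_graph| = \sum_(x < n) \sum_(y < n) ((x < y) && (0 < L x y)).
Proof.
pose P := [set p : 'I_n * 'I_n | (p.1 < p.2) && (0 < L p.1 p.2)].
have -> : edges mx_graph = [set [set p.1; p.2] | p in P].
  apply/setP=> e; apply/idP/imsetP => [|[[x y]]].
    rewrite inE => /existsP[a /existsP[b /andP[ab /eqP->]]].
    have /andP[nab Lab] : mx_adj a b by [].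
    have [ltab|ltba|/val_inj eab] := ltngtP a b.
    - by exists (a, b); rewrite // inE /= ltab.
    - by exists (b, a); rewrite /= 1?setUC // inE /= ltba L_sym.
    - by rewrite eab eqxx in nab.
  rewrite inE /= => /andP[ltxy Lxy] ->; rewrite mem_mx_edges /mx_adj Lxy andbT.
  by apply: contraTneq ltxy => ->; rewrite ltnn.
rewrite card_in_imset => [|[a b] [x y]]; last first.
  rewrite !inE /= => /andP[ltab _] /andP[ltxy _] /set2_inj[[-> ->]|[ea eb]] //.
  by move: ltab; rewrite ea eb ltnNge ltnW.
rewrite -sum1_card pair_big big_mkcond /=.
by apply: eq_bigr => p _; rewrite inE; case: ifP.
Qed.

(** Vertices and edges are as many as the values in the target interval, so
hitting each of these values suffices for bijectivity. *)
Lemma total_mx_label :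
  (forall k, 1 <= k <= n + #|edges mx_graph| -> exists x y, L x y = k) ->
  total_labeling mx_label.
Proof.
move=> Lsurj.
pose s := iota 1 (n + #|edges mx_graph|).
have sub : {subset s <= codom mx_label}.
  move=> k; rewrite mem_iota add1n ltnS => kP; have [x [y Lxy]] := Lsurj k kP.
  have [exy|nxy] := eqVneq x y.
    by apply/codomP; exists (inl x); rewrite -Lxy exy.
  have Exy : [set x; y] \in edges mx_graph.
    by rewrite mem_mx_edges /mx_adj nxy Lxy; case/andP: kP.
  by apply/codomP; exists (inr (exist (fun e => e \in edges mx_graph) _ Exy)); rewrite /= pair_labelE.
have le_size : size (codom mx_label) <= size s.
  by rewrite size_codom size_iota card_sum card_sig card_ord leqnn.
split; first exact/injectiveP/(leq_size_uniq (iota_uniq _ _) sub le_size).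
move=> k; have [_ <-] := uniq_min_size (iota_uniq _ _) sub le_size.
by rewrite mem_iota add1n ltnS card_ord.
Qed.

End LabelMatrix.

(** * The two examples *)

Definition rows_mx (n : nat) (rows : seq (seq nat)) (x y : 'I_n) : nat :=
  nth 0 (nth [::] rows x) y.

Definition triangle_rows : seq (seq nat) :=
  [:: [:: 1; 4; 5];
      [:: 4; 2; 6];
      [:: 5; 6; 3]].

(** The missing edge joins the last two vertices, whose rows both sum to 12;
the first two rows sum to 18 and 21. *)
Definition diamond_rows : seq (seq nat) :=
  [:: [:: 6; 8; 1; 3];
      [:: 8; 7; 2; 4];
      [:: 1; 2; 9; 0];
      [:: 3; 4; 0; 5]].

(** Every hypothesis is a finite computation on the matrix.  Vertex 0 is adjacent
to all others, which gives connectedness, and it forms a triangle with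
vertices 1 and 2. *)
Lemma mx_graph_example (n : nat) (L : 'I_n.+3 -> 'I_n.+3 -> nat)
    (L_sym : forall x y, L x y = L y x) (q : nat) (ws : seq nat) :
  \sum_(x < n.+3) \sum_(y < n.+3) ((x < y) && (0 < L x y)) = q ->
  (forall y, 0 < L ord0 y) -> 0 < L (inord 1) (inord 2) ->
  (forall k, 1 <= k <= n.+3 + q -> exists x y, L x y = k) ->
  size ws <= 3 -> (forall x, \sum_y L x y \in ws) ->
  (forall x y, x != y -> 0 < L x y -> \sum_z L x z != \sum_z L y z) ->
  let G := mx_graph L_sym in
  [/\ connected G, #|edges G| = q, tripartite G & chi_lat G 3].
Proof.
move=> <- L0 L12 Lsurj ws3 wsP wP G; rewrite -card_mx_edges in Lsurj *.
have fP : local_antimagic_total (@mx_label _ _ L_sym).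
  split=> [|u v /andP[nuv Luv]]; first exact: total_mx_label.
  by rewrite !weight_mx_label; apply/eqP/wP.
have f3 : num_weights (@mx_label _ _ L_sym) <= 3.
  apply: leq_trans ws3; apply: uniq_leq_size (undup_uniq _) _ => w.
  by rewrite mem_undup => /imageP[u _ ->]; rewrite weight_mx_label.
have adj0 (y : G) : y != ord0 -> @adj G ord0 y.
  by move=> y0; rewrite /= /mx_adj eq_sym y0 L0.
have [] := @tripartite_chi_lat3 G ord0 (inord 1) (inord 2) _ _ _ _ fP f3.
- by apply: adj0; rewrite -val_eqE /= inordK.
- by apply: adj0; rewrite -val_eqE /= inordK.
- by rewrite /= /mx_adj L12 -val_eqE /= !inordK.
by split=> //; apply: connected_universal adj0.
Qed.

Lemma rows_mx_surj (n N : nat) (rows : seq (seq nat)) :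
  all (fun k => has (fun x => has (fun y => nth 0 (nth [::] rows x) y == k)
                                  (iota 0 n)) (iota 0 n)) (iota 1 N) ->
  forall k, 1 <= k <= N -> exists x y, @rows_mx n rows x y = k.
Proof.
move=> /allP rP k kP; have /rP/hasP[x] : k \in iota 1 N.
  by rewrite mem_iota add1n ltnS.
rewrite mem_iota /= => xn /hasP[y]; rewrite mem_iota /= => yn /eqP <-.
by exists (Ordinal xn), (Ordinal yn).
Qed.

Lemma triangle_sym x y : @rows_mx 3 triangle_rows x y = rows_mx triangle_rows y x.
Proof. by case: x y => [[|[|[|//]]] ?] [[|[|[|//]]] ?]. Qed.

Lemma diamond_sym x y : @rows_mx 4 diamond_rows x y = rows_mx diamond_rows y x.
Proof. by case: x y => [[|[|[|[|//]]]] ?] [[|[|[|[|//]]]] ?]. Qed.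

Theorem theorem2p3 :
  (exists G : sgraph, [/\ unicyclic G, tripartite G & chi_lat G 3]) /\
  (exists H : sgraph, [/\ bicyclic H, tripartite H & chi_lat H 3]).
Proof.
split.
- have [] := @mx_graph_example 0 _ triangle_sym 3 [:: 10; 12; 14].
  + by rewrite !big_ord_recl !big_ord0.
  + by case=> [[|[|[|//]]] ?].
  + by rewrite /rows_mx !inordK.
  + exact: rows_mx_surj.
  + by [].
  + by case=> [[|[|[|//]]] ?]; rewrite !big_ord_recl !big_ord0.
  + by case=> [[|[|[|//]]] ?] [[|[|[|//]]] ?] //; rewrite !big_ord_recl !big_ord0.
  move=> cG qG tG lG; exists (mx_graph triangle_sym).
  by split=> //; split; rewrite // qG card_ord.
- have [] := @mx_graph_example 1 _ diamond_sym 5 [:: 12; 18; 21].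
  + by rewrite !big_ord_recl !big_ord0.
  + by case=> [[|[|[|[|//]]]] ?].
  + by rewrite /rows_mx !inordK.
  + exact: rows_mx_surj.
  + by [].
  + by case=> [[|[|[|[|//]]]] ?]; rewrite !big_ord_recl !big_ord0.
  + by case=> [[|[|[|[|//]]]] ?] [[|[|[|[|//]]]] ?] //; rewrite !big_ord_recl !big_ord0.
  move=> cG qG tG lG; exists (mx_graph diamond_sym).
  by split=> //; split; rewrite // qG card_ord.
Qed.
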